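(* Assume that $\int_0^{+\infty}\lambda(t)\,dt=+\infty$ and that there exists a global minimizer $x^*$ of $f$ over $\mathcal{H}$ such that $$\varphi'\big(f(x)-f^*\big)\,\|\nabla f(x)\|\ \ge\ 1\qquad\text{for all } x\in U(x^*,r^* ),$$ where $r^*\in(0,+\infty]$, $f^*=\min_{\mathcal{H}}f$, $U(x^*,r^* )=\{x\in\mathcal{H}:\|x-x^*\|<r^*\text{ and } f(x)>f^*\}$, and $\varphi(s)=\frac{s^{\theta}}{\kappa\theta}$ for every $s\ge0$, with $\kappa>0$ and $\theta\in(0,1]$ constants. Then there exists $r_0\in(0,r^*]$ such that for every $x_0\in B_{\mathcal{H}}(x^*,r_0)$, the unique global solution $x\in C^1([0,+\infty),\mathcal{H})$ of the gradient system $$x'(t)+\lambda(t)\nabla f(x(t))=0,\quad t\ge0,\qquad x(0)=x_0,$$ converges strongly as $t\to+\infty$ to some global minimizer $x_\infty$ of $f$ over $\mathcal{H}$. Moreover, with $\Gamma(t)=\int_0^t\lambda(s)\,ds$ and all $O(\cdot)$ taken as $t\to+\infty$: (1) If $\theta\in(\tfrac12,1]$, then $f(x_0)=f^*$ and $x(t)=x_0$ for every $t\ge0$. (2) If $\theta=\tfrac12$, then there exists $\delta>0$ such that $$\|x(t)-x_\infty\|=O\big(e^{-\delta\Gamma(t)}\big)\quad\text{and}\quad f(x(t))-f^*=O\big(e^{-\delta\Gamma(t)}\big).$$ (3) If $\theta\in(0,\tfrac12)$, then $$\|x(t)-x_\infty\|=O\Big((\Gamma(t))^{-\frac{\theta}{1-2\theta}}\Big)\quad\text{and}\quad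 f(x(t))-f^*=O\Big((\Gamma(t))^{-\frac{1}{1-2\theta}}\Big).$$
   Context: $\mathcal{H}$ is a real Hilbert space with inner product $\langle\cdot,\cdot\rangle$ and norm $\|\cdot\|$, and $B_{\mathcal{H}}(a,r)$ denotes the ball of center $a$ and radius $r$ in $\mathcal{H}$. $\lambda:[0,+\infty)\to(0,+\infty)$ is an absolutely continuous function belonging to $W^{1,1}_{loc}([0,+\infty))$ (that is, absolutely continuous on each $[0,T]$). $f:\mathcal{H}\to\mathbb{R}$ is a $C^1$ convex function whose gradient $\nabla f$ is locally Lipschitz on $\mathcal{H}$ and which attains its minimum over $\mathcal{H}$. Under these standing assumptions the gradient system $x'(t)+\lambda(t)\nabla f(x(t))=0$, $t\ge0$, $x(0)=x_0$, has, for every $x_0\in\mathcal{H}$, a unique global solution $x\in C^1([0,+\infty),\mathcal{H})$. *)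

(* Defs.v *)
From mathcomp Require Import all_boot all_order all_algebra sesquilinear.
From mathcomp Require Import all_classical all_reals all_analysis.
Import Order.TTheory GRing.Theory Num.Theory.
Import numFieldNormedType.Exports.

Set Implicit Arguments.
Unset Strict Implicit.
Unset Printing Implicit Defensive.

Local Open Scope classical_set_scope.
Local Open Scope ring_scope.

Definition global_minimizer (R : realType) (H : Type) (f : H -> R) (z : H) :=
  forall y, f z <= f y.

(* [g] is the gradient field of [f] for the inner product [dot]: [g y] is the
   Riesz representative of the Frechet differential of [f] at [y]. *)
Definition is_gradient (R : realType) (H : completeNormedModType R)
    (dot : {dot H for (@idfun R)}) (f : H -> R) (g : H -> H) :=
  forall y, is_diff y f (dot (g y)).

Definition abs_continuous (R : realType) (a b : R) (g : R -> R) :=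
  forall e : R, 0 < e -> exists2 d : R, 0 < d &
    forall (n : nat) (u v : 'I_n -> R),
      (forall i, a <= u i /\ u i <= v i /\ v i <= b) ->
      trivIset [set: 'I_n] (fun i => `]u i, v i[%classic) ->
      \sum_(i < n) (v i - u i) < d ->
      \sum_(i < n) `|g (v i) - g (u i)| < e.

(* Derivative at [t >= 0] of a curve on [0, +oo[: one-sided at [t = 0], and it
   never looks at the values of [x] at negative times. *)
Definition is_derive_halfline (R : realType) (H : completeNormedModType R)
    (x : R -> H) (t : R) (v : H) :=
  h^-1 *: (x (t + h) - x t) @[h --> within [set h | 0 <= t + h] 0^'] --> v.

Definition gradient_solution (R : realType) (H : completeNormedModType R)
    (lambda : R -> R) (gradf : H -> H) (x0 : H) (x : R -> H) :=
  exists x' : R -> H,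
    [/\ forall t : R, 0 <= t -> is_derive_halfline x t (x' t),
        {within `[0, +oo[, continuous x'},
        forall t : R, 0 <= t -> x' t + lambda t *: gradf (x t) = 0
      & x 0 = x0].

Definition phi (R : realType) (kappa theta s : R) : R :=
  s `^ theta / (kappa * theta).

Definition Gamma (R : realType) (lambda : R -> R) (t : R) : R :=
  \int[lebesgue_measure]_(s in `[0, t]) lambda s.

(* The filter of neighborhoods of +oo, packaged for the Landau notations. *)
Canonical pinfty_filter_on (R : realType) : filter_on R :=
  FilterType (pinfty_nbhs R) _.

(* Main.v *)
(* Write [h t = f (x t) - f xstar] along the flow. Convexity makes the distance
   to every minimizer nonincreasing, so the trajectory stays in the region where
   the KL inequality [kappa h^(1 - theta) <= |grad f|] holds. Together with
   [h' = - lambda |grad f|^2] and [|x'| = lambda |grad f|] it gives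
   [(h^theta)' <= - kappa theta |x'|]: the length travelled after time [t] is at
   most [h(t)^theta / (kappa theta)]. Since [h Gamma + |x - xstar|^2 / 2] is
   nonincreasing and [Gamma] is unbounded, [h] tends to 0, whence convergence.
   The rates come from [h' <= - kappa^2 lambda h^(2 - 2 theta)]. When
   [theta > 1/2], the bound [|grad f|^2 <= 4 L h] valid near [xstar] contradicts
   the KL inequality unless [f] is constant around [xstar]. *)
Require Import Defs.
From mathcomp Require Import all_boot all_order all_algebra sesquilinear.
From mathcomp Require Import all_classical all_reals all_analysis.
From mathcomp Require Import ring lra.
Import Order.TTheory GRing.Theory Num.Theory.
Import numFieldNormedType.Exports.

Local Open Scope classical_set_scope.
Local Open Scope ring_scope.

(** * Inner product calculus and derivatives of curves *)

Section InnerProduct.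
Context (R : realType) (H : completeNormedModType R).
Variable dot : {dot H for (@idfun R)}.
Hypothesis dot_norm : forall u : H, `|u| ^+ 2 = dot u u.

Lemma dotC (u v : H) : dot u v = dot v u.
Proof. by rewrite hermC expr0 mul1r. Qed.

Lemma dot0l (u : H) : dot 0 u = 0. Proof. exact: linear0l. Qed.

Lemma dotDl (u v w : H) : dot (u + v) w = dot u w + dot v w.
Proof. exact: linearDl. Qed.

Lemma dotNl (u v : H) : dot (- u) v = - dot u v.
Proof. exact: linearNl. Qed.

Lemma dotZl (a : R) (u v : H) : dot (a *: u) v = a * dot u v.
Proof. exact: linearZl_LR. Qed.

Lemma dotDr (u v w : H) : dot w (u + v) = dot w u + dot w v.
Proof. exact: linearDr. Qed.

Lemma dotNr (u v : H) : dot v (- u) = - dot v u.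
Proof. exact: linearNr. Qed.

Lemma dotZr (a : R) (u v : H) : dot v (a *: u) = a * dot v u.
Proof. exact: linearZr_LR. Qed.

Definition dotE := (dotDl, dotDr, dotNl, dotNr, dotZl, dotZr).

(** The form is tied to the topology only through [dot_norm]; writing it with norms is what yields
    its continuity in [cvg_dot]. *)
Lemma polarization (u v : H) :
  dot u v = 4^-1 * (`|u + v| ^+ 2 - `|u - v| ^+ 2).
Proof.
by rewrite !dot_norm !dotE (dotC v u); field.
Qed.

Lemma dot_cauchy_schwarz (u v : H) : dot u v <= `|u| * `|v|.
Proof.
have [->|u0] := eqVneq u 0; first by rewrite dot0l normr0 mul0r.
have nu : 0 < `|u| by rewrite normr_gt0.
(* Expanded, this square is [2 |u| |v| (|u| |v| - dot u v)]. *)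
have : 0 <= `| `|v| *: u - `|u| *: v| ^+ 2 by exact: sqr_ge0.
rewrite dot_norm !dotE (dotC v u) -!dot_norm => h.
have [->|v0] := eqVneq v 0; first by rewrite dotC dot0l normr0 mulr0.
have nv : 0 < `|v| by rewrite normr_gt0.
have : 0 <= (`|u| * `|v|) * (`|u| * `|v| - dot u v) by nra.
by rewrite pmulr_rge0 ?mulr_gt0// subr_ge0.
Qed.

Lemma cvg_dot (T : Type) (F : set_system T) (FF : Filter F)
    (u v : T -> H) (a b : H) :
  u @ F --> a -> v @ F --> b -> dot (u t) (v t) @[t --> F] --> dot a b.
Proof.
move=> ua vb; rewrite polarization.
rewrite (_ : (fun t => dot (u t) (v t)) =
  fun t => 4^-1 * (`|u t + v t| ^+ 2 - `|u t - v t| ^+ 2)); last first.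
  by apply/funext => t; rewrite polarization.
apply: cvgM; first exact: cvg_cst.
by apply: cvgB; apply: cvgM; apply: cvg_norm; (apply: cvgD + apply: cvgB).
Qed.

Lemma is_derive_cvg (V : normedModType R) (x : R -> V) (t : R) (v : V) :
  h^-1 *: (x (h + t) - x t) @[h --> 0^'] --> v -> is_derive t 1 x v.
Proof.
move=> xv.
have e : (fun h : R => h^-1 *: ((x \o shift t) (h *: 1) - x t)) =
         (fun h : R => h^-1 *: (x (h + t) - x t)).
  by apply/funext => h; rewrite /= [h *: 1]mulr1.
by apply: DeriveDef; rewrite /derivable /derive e; [apply/cvg_ex; exists v|
  apply/cvg_lim].
Qed.

Lemma is_derive_cvgE (V : normedModType R) (x : R -> V) (t : R) (v : V) :
  is_derive t 1 x v -> h^-1 *: (x (h + t) - x t) @[h --> 0^'] --> v.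
Proof.
case; rewrite /derivable /derive => /[swap] <-.
suff -> : (fun h : R => h^-1 *: ((x \o shift t) (h *: 1) - x t)) =
         (fun h : R => h^-1 *: (x (h + t) - x t)) by [].
by apply/funext => h; rewrite /= [h *: 1]mulr1.
Qed.

Lemma is_derive_continuous (V : normedModType R) (x : R -> V) (t : R) (v : V) :
  is_derive t 1 x v -> {for t, continuous x}.
Proof.
by move=> [/derivable1_diffP dx _]; exact: differentiable_continuous dx.
Qed.

Lemma is_derive_shift_cvg (V : normedModType R) (x : R -> V) (t : R) (v : V) :
  is_derive t 1 x v -> x (h + t) @[h --> 0^'] --> x t.
Proof.
move=> /is_derive_continuous xc.
have : x (h + t) @[h --> 0] --> x (0 + t).
  apply: (@continuous_comp _ _ _ (fun h => h + t) x); last by rewrite add0r.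
  by apply: cvgD; [exact: cvg_id|exact: cvg_cst].
by rewrite add0r => /cvg_within_filter; apply.
Qed.

Lemma is_derive_dot (x : R -> H) (t : R) (w v : H) :
  is_derive t 1 x v -> is_derive t 1 (fun s => dot w (x s)) (dot w v).
Proof.
move=> /is_derive_cvgE xv; apply: is_derive_cvg.
rewrite (_ : (fun h => _) = fun h => dot w (h^-1 *: (x (h + t) - x t))).
  by apply: cvg_dot => //; exact: cvg_cst.
by apply/funext => h; rewrite !dotE.
Qed.

(** The identity [|a|^2 - |b|^2 = dot (a + b) (a - b)] turns the difference quotient into an inner
    product of two convergent factors. *)
Lemma is_derive_sqr_norm (x : R -> H) (t : R) (z v : H) :
  is_derive t 1 x v ->
  is_derive t 1 (fun s => `|x s - z| ^+ 2) (2 * dot (x t - z) v).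
Proof.
move=> dx; apply: is_derive_cvg.
rewrite (_ : (fun h => _) = fun h =>
  dot ((x (h + t) - z) + (x t - z)) (h^-1 *: (x (h + t) - x t))).
  rewrite mulr_natl mulr2n -dotDl.
  apply: cvg_dot; last exact: is_derive_cvgE.
  apply: cvgD; last exact: cvg_cst.
  by apply: cvgB; [exact: is_derive_shift_cvg dx|exact: cvg_cst].
apply/funext => h; rewrite dotZr; congr (_ * _).
rewrite !dot_norm.
rewrite !dotE (dotC (x t) (x (h + t))) !(dotC z).
ring.
Qed.

End InnerProduct.

(** * Chain rule along a curve and monotonicity from the sign of the derivative *)

Lemma is_derive_comp_diff (R : realType) (V W : normedModType R)
    (f df : V -> W) (x : R -> V) (t : R) (v : V) :
  is_diff (x t) f df -> is_derive t 1 x v -> is_derive t 1 (f \o x) (df v).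
Proof.
move=> dfx [/derivable1_diffP dx xv].
have dfx' : differentiable f (x t) by exact: ex_diff.
apply: DeriveDef.
  by apply/derivable1_diffP; exact: differentiable_comp.
rewrite deriveE; last exact: differentiable_comp.
by rewrite diff_comp//= -xv deriveE// diff_val.
Qed.

Lemma powR_subr1_mul (R : realType) (s theta : R) : 0 < s ->
  s `^ (theta - 1) * s `^ (1 - theta) = 1.
Proof.
move=> s0; rewrite -powRD; last by apply/implyP => _; rewrite gt_eqF.
by rewrite addrA subrK subrr powRr0.
Qed.

(* Differentiability on ]0, +oo[ gives continuity everywhere but at 0, whence
   the one-sided assumption there. *)
Lemma le0_derive_nincr (R : realType) (u u' : R -> R) (a b : R) :
  0 <= a -> a <= b -> u s @[s --> 0^'+] --> u 0 ->
  (forall s, 0 < s -> a <= s <= b -> is_derive s 1 u (u' s)) ->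
  (forall s, 0 < s -> a <= s <= b -> u' s <= 0) ->
  u b <= u a.
Proof.
move=> a0; rewrite le_eqVlt => /predU1P[->//|ab] u0 du u'0.
have cu s : 0 < s -> a <= s <= b -> {for s, continuous u}.
  by move=> s0 /(du _ s0); exact: is_derive_continuous.
have ab0 s : s \in `]a, b[%R -> 0 < s /\ a <= s <= b.
  rewrite in_itv/= => /andP[as_ sb]; rewrite (le_lt_trans a0 as_).
  by rewrite !ltW.
have b0 : 0 < b by exact: le_lt_trans ab.
apply: (@ler0_derive1_le_cc R u a b _ _ _ b a); rewrite ?in_itv/= ?lexx ?ltW//.
- by move=> s /ab0[s0 sab]; case: (du s s0 sab).
- move=> s /ab0[s0 sab]; rewrite derive1E.
  by have [_ ->] := du s s0 sab; exact: u'0.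
- apply/continuous_within_itvP => //; split.
  + by move=> s /ab0[s0 sab]; exact: cu.
  + move: a0; rewrite le_eqVlt => /predU1P[<-//|a0].
    by apply: cvg_at_right_filter; apply: cu => //; rewrite lexx ltW.
  + by apply: cvg_at_left_filter; apply: cu => //; rewrite lexx ltW.
Qed.

(** * First-order inequalities for a convex function *)

Section Convex.
Context (R : realType) (H : completeNormedModType R).
Variable dot : {dot H for (@idfun R)}.
Hypothesis dot_norm : forall u : H, `|u| ^+ 2 = dot u u.
Variables (f : H -> R) (g : H -> H).
Hypothesis f_convex : convex_function [set: convex_lmodType H] f.
Hypothesis f_grad : is_gradient dot f g.

Lemma cvg_grad_quotient (y v : H) :
  h^-1 *: (f (h *: v + y) - f y) @[h --> 0^'] --> dot (g y) v.
Proof.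
have dx : is_derive (0 : R) 1 (fun s : R => s *: v + y) v.
  apply: is_derive_cvg; apply: cvg_near_cst; near=> h.
  rewrite scale0r add0r addr0 addrK scalerA mulVf ?scale1r//.
  by near: h; exact: nbhs_dnbhs_neq.
have := @is_derive_comp_diff _ _ _ f (dot (g y)) _ 0 _ _ dx.
rewrite /= scale0r add0r => /(_ (f_grad y)) /is_derive_cvgE /=.
rewrite scale0r add0r; apply: cvg_trans; apply: near_eq_cvg; near=> h.
by rewrite addr0.
Unshelve. all: by end_near. Qed.

(** For [0 < s <= 1], convexity on the segment from [y] to [z] bounds the difference quotient of
    step [s] by [f z - f y]; then [s] tends to 0 from the right. *)
Lemma convex_grad_ge (y z : H) : f y + dot (g y) (z - y) <= f z.
Proof.
have /cvg_dnbhs_at_right h := cvg_grad_quotient y (z - y).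
rewrite addrC -lerBrDr; apply: (cvgr_to_le h); near=> s.
have s0 : 0 < s by near: s; exact: nbhs_right_gt.
have s1 : s <= 1 by near: s; apply: nbhs_right_le.
rewrite /GRing.scale/= mulrC ler_pdivrMr//.
have := f_convex (Itv01 (ltW s0) s1) z y.
rewrite !inE => /(_ I I) /=; rewrite convRE.
have -> : conv (Itv01 (ltW s0) s1) (z : convex_lmodType H) y = s *: (z - y) + y.
  transitivity (s *: (z : H) + (1 - s) *: (y : H)) => //.
  by rewrite scalerBr scalerBl scale1r addrA addrAC.
by rewrite /= /unstable.onem; lra.
Unshelve. all: by end_near. Qed.

Lemma is_gradient_continuous : continuous f.
Proof.
by move=> y; apply: differentiable_continuous; have [] := f_grad y.
Qed.

(** In the direction [g z], the quotients with negative step are nonpositive at a minimizer, and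
    they tend to [|g z|^2]. *)
Lemma grad_minimizer (z : H) : global_minimizer f z -> g z = 0.
Proof.
move=> fz; have /cvg_dnbhs_at_left h := cvg_grad_quotient z (g z).
have : dot (g z) (g z) <= 0.
  apply: (cvgr_to_le h); near=> s.
  by rewrite /GRing.scale/= nmulr_rle0 ?subr_ge0 ?invr_lt0.
by rewrite -dot_norm real_exprn_even_le0//= normr_eq0 => /eqP.
Unshelve. all: by end_near. Qed.

(* Taking a gradient step of length [1 / (2 L)] from [y] stays in the ball where
   the gradient is [L]-Lipschitz and decreases [f] by [|g y|^2 / (4 L)]. *)
Lemma sqr_grad_le_gap (xs : H) (L rho : R) :
  global_minimizer f xs -> 0 < L ->
  (forall y z, `|y - xs| < 2 * rho -> `|z - xs| < 2 * rho ->
    `|g y - g z| <= L * `|y - z|) ->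
  forall y, `|y - xs| < rho -> `|g y| ^+ 2 <= 4 * L * (f y - f xs).
Proof.
move=> xs_min L0 gL y yrho.
have rho0 : 0 < rho by exact: le_lt_trans yrho.
have gxs := grad_minimizer _ xs_min.
have gy : `|g y| <= L * `|y - xs|.
  rewrite -[g y]subr0 -gxs; apply: gL; first lra.
  by rewrite subrr normr0; lra.
pose z := y - (2 * L)^-1 *: g y.
have c0 : 0 < (2 * L)^-1 by rewrite invr_gt0; lra.
have cL : (2 * L)^-1 * L = 2^-1 by field; lra.
have zy : `|z - y| = (2 * L)^-1 * `|g y|.
  by rewrite /z addrAC subrr add0r normrN normrZ gtr0_norm.
(* Since [g xs = 0], the step from [y] to [z] has length at most [|y - xs| / 2]. *)
have zxs : `|z - xs| < 2 * rho.
  rewrite -(subrK y z) -addrA; apply: (le_lt_trans (ler_normD _ _)).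
  rewrite zy; have := ler_wpM2l (ltW c0) gy.
  by rewrite mulrA cL; have := normr_ge0 (y - xs); lra.
have gz : `|g z - g y| <= L * `|z - y| by apply: gL => //; lra.
(* Convexity gives [f y - f z >= dot (g z) (y - z)]. Replacing [g z] by [g y] costs at most
   [L |z - y|^2 = |g y|^2 / (4 L)], half of the main term [|g y|^2 / (2 L)]. *)
have := convex_grad_ge z y; have := xs_min z.
have -> : dot (g z) (y - z) =
    dot (g y) (y - z) + dot (g z - g y) (y - z).
  by rewrite -dotDl addrCA subrr addr0.
have -> : dot (g y) (y - z) = (2 * L)^-1 * `|g y| ^+ 2.
  by rewrite /z opprB addrC subrK dotZr dot_norm.
have : - (L * `|z - y| * `|z - y|) <= dot (g z - g y) (y - z).
  rewrite lerNl -dotNr opprB.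
  apply: (le_trans (dot_cauchy_schwarz _ _ _ dot_norm _ _)).
  by rewrite ler_wpM2r.
rewrite zy.
have -> : L * ((2 * L)^-1 * `|g y|) * ((2 * L)^-1 * `|g y|) =
   (4 * L)^-1 * `|g y| ^+ 2 by field; lra.
have -> : (2 * L)^-1 * `|g y| ^+ 2 = 2 * ((4 * L)^-1 * `|g y| ^+ 2).
  by field; lra.
move=> h1 h2 h3.
rewrite -ler_pdivrMl; last lra.
by lra.
Qed.

End Convex.

(** * The primitive [Gamma] of [lambda] *)

Section GammaTheory.
Context (R : realType) (lambda : R -> R).
Hypothesis lambda_ac : forall T : R, 0 <= T -> abs_continuous 0 T lambda.

Lemma abs_continuous_halfline : {within `[0, +oo[, continuous lambda}.
Proof.
apply/subspace_continuousP => t; rewrite /= in_itv/= andbT => t0.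
apply/cvgrPdist_lt => e e0.
have [|d d0 dP] := lambda_ac (t + 1) _ e e0; first lra.
(* The cap at 1 keeps [s] below [t + 1]; absolute continuity is then applied to the single interval
   between [s] and [t]. *)
have d10 : 0 < Order.min d 1 by rewrite lt_min d0 ltr01.
apply/nbhs_ballP; exists (Order.min d 1) => //= s.
rewrite /ball/= lt_min => /andP[sd s1]; rewrite in_itv/= andbT => s0.
have [ts|st] := leP t s.
  have := dP 1%N (fun _ => t) (fun _ => s); rewrite !big_ord1 distrC; apply.
  - move=> _; rewrite ts t0; split => //; split => //.
    by move: s1; rewrite ltr_norml; lra.
  - by move=> i j _ _ _; rewrite !ord1.
  - by rewrite distrC ger0_norm ?subr_ge0// in sd.
have := dP 1%N (fun _ => s) (fun _ => t); rewrite !big_ord1; apply.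
- by move=> _; split => //; split; lra.
- by move=> i j _ _ _; rewrite !ord1.
- by rewrite gtr0_norm ?subr_gt0// in sd.
Qed.

Let lambda_integrable (t : R) :
  lebesgue_measure.-integrable `[0, t] (EFin \o lambda).
Proof.
apply: continuous_compact_integrable; first exact: segment_compact.
apply: continuous_subspaceW abs_continuous_halfline.
by apply: subset_itvl.
Qed.

Lemma Gamma0 : Gamma lambda 0 = 0.
Proof. by rewrite /Gamma set_itv1 Rintegral_set1. Qed.

Lemma is_derive_Gamma (t : R) :
  0 < t -> is_derive t 1 (Gamma lambda) (lambda t).
Proof.
move=> t0; have lt : {for t, continuous lambda}.
  have /continuous_within_itvcyP[+ _] := abs_continuous_halfline.
  by apply; rewrite in_itv/= andbT.
have [|dG G'] := @continuous_FTC1_closed R lambda 0 t (t + 1) _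
  (lambda_integrable (t + 1)) t0 lt; first by rewrite ltrDl.
by apply: DeriveDef => //; rewrite -derive1E.
Qed.

Lemma cvg_Gamma0 : Gamma lambda s @[s --> 0^'+] --> Gamma lambda 0.
Proof.
have := parameterized_integral_continuous (ler01 : 0 <= 1 :> R)
  (lambda_integrable 1).
by case/(continuous_within_itvP _ ltr01).
Qed.

Hypothesis lambda_gt0 : forall t : R, 0 <= t -> 0 < lambda t.

Lemma Gamma_ndecr (s t : R) : 0 <= s -> s <= t ->
  Gamma lambda s <= Gamma lambda t.
Proof.
move=> s0 st; rewrite -lerN2.
apply: (@le0_derive_nincr _ (fun t => - Gamma lambda t)
  (fun t => - lambda t)) => //.
- by apply: cvgN; exact: cvg_Gamma0.
- by move=> r r0 _; apply: is_deriveN; exact: is_derive_Gamma.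
- by move=> r r0 _; rewrite oppr_le0 ltW// lambda_gt0// ltW.
Qed.

Lemma Gamma_ge0 (t : R) : 0 <= t -> 0 <= Gamma lambda t.
Proof. by move=> t0; rewrite -Gamma0 Gamma_ndecr. Qed.

(** If the monotone function [Gamma] were bounded, it would have a finite limit, and the fundamental
    theorem of calculus on the half-line would make the integral of [lambda] finite. *)
Lemma cvg_Gamma_pinfty :
  (\int[lebesgue_measure]_(t in `[0%R, +oo[) (lambda t)%:E = +oo)%E ->
  Gamma lambda t @[t --> +oo] --> +oo.
Proof.
move=> lambda_int; apply/cvgryPge => A.
suff [T T0 AT] : exists2 T : R, 0 <= T & A <= Gamma lambda T.
  near=> t; apply: (le_trans AT); apply: Gamma_ndecr; first exact: T0.
  by near: t; apply: nbhs_pinfty_ge; rewrite num_real.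
apply: contrapT => /forall2NP AG.
have GA t : 0 <= t -> Gamma lambda t <= A.
  by move=> t0; have [//|/negP] := AG t; rewrite -ltNge => /ltW.
(* Clamping at 0 makes the function monotone on the whole line without changing it near [+oo]. *)
pose G t := Gamma lambda (Order.max 0 t).
have Gcvg : G t @[t --> +oo] --> sup (range G).
  apply: nondecreasing_cvgr.
    move=> s t st; apply: Gamma_ndecr; first by rewrite le_max lexx.
    by rewrite ge_max le_max lexx/= le_max st orbT.
  exists A => _ [t _ <-]; apply: GA; by rewrite le_max lexx.
have {}Gcvg : Gamma lambda t @[t --> +oo] --> sup (range G).
  apply: cvg_trans Gcvg; apply: near_eq_cvg; near=> t.
  by rewrite /G max_r//; near: t; apply: nbhs_pinfty_ge; rewrite num_real.
have := @ge0_continuous_FTC2y R lambda (Gamma lambda) 0 (sup (range G)).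
rewrite lambda_int => /(_ _ abs_continuous_halfline Gcvg) h.
suff : (+oo = (sup (range G))%:E - (Gamma lambda 0)%:E)%E by [].
apply: h.
- by move=> t t0; exact/ltW/lambda_gt0.
- by move=> t t0; have [] := is_derive_Gamma _ t0.
- exact: cvg_Gamma0.
- move=> t; rewrite in_itv/= andbT => t0; rewrite derive1E.
  by have [_ ->] := is_derive_Gamma _ t0.
Unshelve. all: by end_near. Qed.

End GammaTheory.

(** * From the half-line derivative to two-sided derivatives and continuity at 0 *)

Section GradientSolution.
Context (R : realType) (H : completeNormedModType R).
Variables (lambda : R -> R) (g : H -> H) (x0 : H) (x : R -> H).
Hypothesis x_sol : gradient_solution lambda g x0 x.

(** For [t > 0] the constraint [0 <= t + h] holds for all small [h], so the half-line derivative is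
    the usual one. *)
Lemma gradient_solution_derive (t : R) :
  0 < t -> is_derive t 1 x (- lambda t *: g (x t)).
Proof.
case: x_sol => x' [dx _ ode _] t0.
have -> : - lambda t *: g (x t) = x' t.
  apply/esym/eqP; rewrite scaleNr -addr_eq0; apply/eqP; apply: ode.
  exact: ltW.
apply: is_derive_cvg.
rewrite (_ : (fun h => _) = fun h => h^-1 *: (x (t + h) - x t)); last first.
  by apply/funext => h; rewrite (addrC h).
have t0h : \forall h \near 0^', 0 <= t + h.
  apply: nbhs_dnbhs; apply/nbhs_ballP; exists t => //= h.
  rewrite /ball/= sub0r normrN ltr_norml => /andP[h0 _].
  by rewrite -lerBlDl sub0r ltW.
apply: cvg_trans (dx t (ltW t0)); apply: cvg_app => A tA.
by apply: filterS2 t0h tA => h /[swap]; apply.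
Qed.

(** The quotient at 0 has a limit from the right, so its product with [h] tends to 0. *)
Lemma gradient_solution_cvg0 : x s @[s --> 0^'+] --> x 0.
Proof.
case: x_sol => x' [dx _ _ _]; have := dx 0 (lexx 0) => {}dx.
have {}dx : h^-1 *: (x (0 + h) - x 0) @[h --> 0^'+] --> x' 0.
  apply: cvg_trans dx; apply: cvg_app => A hA.
  apply: (@filterS _ (nbhs (0 : R)) _ _ _ _ hA) => s sA s0.
  by apply: sA; rewrite /= ?gt_eqF// add0r ltW.
have {}dx : h *: (h^-1 *: (x (0 + h) - x 0)) @[h --> 0^'+] --> (0 : H).
  rewrite -(scale0r (x' 0)); apply: cvgZ dx.
  exact: cvg_at_right_filter cvg_id.
have : h *: (h^-1 *: (x (0 + h) - x 0)) + x 0 @[h --> 0^'+] --> 0 + x 0.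
  by apply: cvgD dx _; exact: cvg_cst.
rewrite add0r; apply: cvg_trans; apply: near_eq_cvg; near=> s.
have s0 : s != 0 by rewrite gt_eqF//; near: s; exact: nbhs_right_gt.
by rewrite add0r scalerA mulfV// scale1r /= addrNK.
Unshelve. all: by end_near. Qed.

End GradientSolution.

(** * Energy estimates, length bound, convergence and rates along the flow *)

Section GradientFlow.
Context (R : realType) (H : completeNormedModType R).
Variable dot : {dot H for (@idfun R)}.
Hypothesis dot_norm : forall u : H, `|u| ^+ 2 = dot u u.
Variables (lambda : R -> R) (f : H -> R) (g : H -> H) (x : R -> H).
Hypothesis f_convex : convex_function [set: convex_lmodType H] f.
Hypothesis f_grad : is_gradient dot f g.
Hypothesis lambda_gt0 : forall t : R, 0 <= t -> 0 < lambda t.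
Hypothesis lambda_ac : forall T : R, 0 <= T -> abs_continuous 0 T lambda.
Hypothesis dx : forall t : R, 0 < t -> is_derive t 1 x (- lambda t *: g (x t)).
Hypothesis x_cvg0 : x s @[s --> 0^'+] --> x 0.

(** By convexity, half the derivative of [|x t - z|^2] is at most [lambda t * (f z - f (x t))],
    which is nonpositive. *)
Lemma flow_dist_nincr (z : H) (s t : R) : global_minimizer f z ->
  0 <= s -> s <= t -> `|x t - z| <= `|x s - z|.
Proof.
move=> fz s0 st; rewrite -(@ler_pXn2r _ 2)// ?nnegrE//.
apply: (@le0_derive_nincr _ (fun t => `|x t - z| ^+ 2)
  (fun t => 2 * dot (x t - z) (- lambda t *: g (x t)))) => //.
- by apply: cvgM; apply: cvg_norm; apply: cvgB => //; exact: cvg_cst.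
- by move=> r r0 _; apply: is_derive_sqr_norm => //; exact: dx.
- move=> r r0 _.
  have := convex_grad_ge _ _ _ _ _ f_convex f_grad (x r) z.
  rewrite -[z - x r]opprB dotNr dotC dotZr => h.
  have := fz (x r); have := lambda_gt0 r (ltW r0).
  by nra.
Qed.

(** The distance to the minimizer [x s] itself is nonincreasing and starts at 0. *)
Lemma flow_stationary (s t : R) : global_minimizer f (x s) ->
  0 <= s -> s <= t -> x t = x s.
Proof.
move=> fxs s0 st; have := flow_dist_nincr _ _ _ fxs s0 st.
by rewrite subrr normr0 normr_le0 subr_eq0 => /eqP.
Qed.

Lemma is_derive_flow_value (t : R) : 0 < t ->
  is_derive t 1 (f \o x) (- (lambda t * `|g (x t)| ^+ 2)).
Proof.
move=> t0.
have := @is_derive_comp_diff _ _ _ f _ x t _ (f_grad (x t)) (dx t t0).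
by rewrite dotZr dot_norm mulNr.
Qed.

Lemma flow_value_cvg0 : (f \o x) s @[s --> 0^'+] --> (f \o x) 0.
Proof. by apply: continuous_cvg x_cvg0; exact: is_gradient_continuous. Qed.

Lemma flow_value_nincr (s t : R) : 0 <= s -> s <= t -> f (x t) <= f (x s).
Proof.
move=> s0 st.
apply: (@le0_derive_nincr _ (f \o x)
  (fun t => - (lambda t * `|g (x t)| ^+ 2))) => //.
- exact: flow_value_cvg0.
- by move=> r r0 _; exact: is_derive_flow_value.
- move=> r r0 _; rewrite oppr_le0 mulr_ge0 ?sqr_ge0//.
  by apply/ltW/lambda_gt0/ltW.
Qed.

Variable xs : H.
Hypothesis xs_min : global_minimizer f xs.

Let h (t : R) := f (x t) - f xs.

Let h_ge0 (t : R) : 0 <= h t.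
Proof. by rewrite /h subr_ge0; exact: xs_min. Qed.

Let h_nincr (s t : R) : 0 <= s -> s <= t -> h t <= h s.
Proof. by move=> s0 st; rewrite /h lerD2r; exact: flow_value_nincr. Qed.

Let dh (t : R) : 0 < t -> is_derive t 1 h (- (lambda t * `|g (x t)| ^+ 2)).
Proof.
move=> t0; rewrite -[X in is_derive _ _ _ X]subr0.
by apply: is_deriveB; exact: is_derive_flow_value.
Qed.

Let h_cvg0 : h s @[s --> 0^'+] --> h 0.
Proof. by apply: cvgB; [exact: flow_value_cvg0|exact: cvg_cst]. Qed.

(** In the derivative of [|x - xs|^2 / 2 + h Gamma], the term [lambda h] coming from [Gamma] is
    absorbed by the convexity bound on the first summand; what remains is at most
    [- Gamma lambda |g|^2]. *)
Lemma flow_gap_Gamma (t : R) : 0 <= t ->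
  (f (x t) - f xs) * Gamma lambda t <= 2^-1 * `|x 0 - xs| ^+ 2.
Proof.
move=> t0.
suff : 2^-1 * `|x t - xs| ^+ 2 + h t * Gamma lambda t <=
       2^-1 * `|x 0 - xs| ^+ 2 + h 0 * Gamma lambda 0.
  rewrite Gamma0 mulr0 addr0; apply: le_trans.
  by rewrite lerDr mulr_ge0// sqr_ge0.
pose v r := - (lambda r * `|g (x r)| ^+ 2).
apply: (@le0_derive_nincr _
  (fun r => 2^-1 * `|x r - xs| ^+ 2 + h r * Gamma lambda r)
  (fun r => 2^-1 * (2 * dot (x r - xs) (- lambda r *: g (x r))) +
    (h r * lambda r + Gamma lambda r * v r))) => //.
- apply: cvgD.
    apply: cvgM; first exact: cvg_cst.
    by apply: cvgM; apply: cvg_norm; apply: cvgB => //; exact: cvg_cst.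
  by apply: cvgM => //; exact: cvg_Gamma0.
- move=> r r0 _; apply: is_deriveD.
    by apply: is_deriveZ; apply: is_derive_sqr_norm => //; exact: dx.
  by apply: is_deriveM; [exact: dh|exact: is_derive_Gamma].
- move=> r r0 _.
  have := convex_grad_ge _ _ _ _ _ f_convex f_grad (x r) xs.
  rewrite -[xs - x r]opprB dotNr [dot (x r - xs) _]dotC dotZl => hr.
  have l0 := lambda_gt0 r (ltW r0).
  have G0 := Gamma_ge0 _ lambda lambda_ac lambda_gt0 _ (ltW r0).
  have : 0 <= Gamma lambda r * (lambda r * `|g (x r)| ^+ 2).
    by rewrite mulr_ge0// mulr_ge0// ?sqr_ge0// ltW.
  by rewrite /v /h mulrN; nra.
Qed.

Lemma flow_value_cvg : Gamma lambda t @[t --> +oo] --> +oo ->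
  f (x t) @[t --> +oo] --> f xs.
Proof.
move=> Goo; pose C := 2^-1 * `|x 0 - xs| ^+ 2.
have C0 : 0 <= C by rewrite mulr_ge0// sqr_ge0.
apply/cvgrPdist_le => e e0; near=> t.
have t0 : 0 <= t by near: t; apply: nbhs_pinfty_ge; rewrite num_real.
rewrite distrC ger0_norm ?h_ge0//.
(* The summand 1 keeps [Gamma] positive even when [C = 0], so that one may divide by it. *)
have G1 : 1 + C / e <= Gamma lambda t by near: t; move/cvgryPge : Goo; exact.
have Ce : 0 <= C / e by rewrite divr_ge0// ltW.
have G0 : 0 < Gamma lambda t by lra.
have := flow_gap_Gamma t t0; rewrite -/C -ler_pdivlMr// => /le_trans; apply.
rewrite ler_pdivrMr// mulrC -ler_pdivrMr//; lra.
Unshelve. all: by end_near. Qed.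

Variables (kappa theta : R).
Hypothesis kappa_gt0 : 0 < kappa.
Hypothesis theta_gt0 : 0 < theta.
Hypothesis KL : forall t : R, 0 <= t -> 0 < f (x t) - f xs ->
  kappa * (f (x t) - f xs) `^ (1 - theta) <= `|g (x t)|.

(* The function [<w, x r> + |w| h(r)^theta / (kappa theta)] with
   [w = x t - x s] is nonincreasing. *)
Lemma flow_length_pos (s t : R) : 0 <= s -> s <= t -> 0 < f (x t) - f xs ->
  `|x t - x s| <= (f (x s) - f xs) `^ theta / (kappa * theta).
Proof.
move=> s0 st ht; set w := x t - x s.
have kt : 0 < kappa * theta by rewrite mulr_gt0.
have hr r : 0 < r -> s <= r <= t -> 0 < h r.
  move=> r0 /andP[_ rt]; apply: (lt_le_trans ht); apply: h_nincr => //.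
  exact: ltW.
have h0 : 0 < h 0.
  by apply: (lt_le_trans ht); apply: h_nincr => //; exact: le_trans st.
have : dot w (x t) + `|w| / (kappa * theta) * h t `^ theta <=
       dot w (x s) + `|w| / (kappa * theta) * h s `^ theta.
  apply: (@le0_derive_nincr _
    (fun r => dot w (x r) + `|w| / (kappa * theta) * h r `^ theta)
    (fun r => dot w (- lambda r *: g (x r)) + `|w| / (kappa * theta) *
      (theta * h r `^ (theta - 1) * - (lambda r * `|g (x r)| ^+ 2)))) => //.
  - apply: cvgD; first by apply: cvg_dot => //; exact: cvg_cst.
    apply: cvgM; first exact: cvg_cst.
    apply: (@continuous_cvg _ _ _ _ _ h (fun r => r `^ theta)) => //.
    exact: is_derive_continuous (is_derive1_powR theta h0).
  - move=> r r0 srt; apply: is_deriveD.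
      by apply: is_derive_dot => //; exact: dx.
    apply: is_deriveZ.
    apply: (@is_derive1_comp _ (fun r => r `^ theta) h); last exact: dh.
    by apply: is_derive1_powR; exact: hr.
  - move=> r r0 srt.
    have l0 := lambda_gt0 r (ltW r0).
    have hr0 := hr r r0 srt.
    have CS : - dot w (g (x r)) <= `|w| * `|g (x r)|.
      rewrite -dotNr -(normrN (g (x r))).
      exact: dot_cauchy_schwarz.
    (* In this form the KL inequality makes the dissipation term outweigh [lambda |w| |g|], the
       Cauchy-Schwarz bound on the derivative of the linear term. *)
    have kl : kappa <= h r `^ (theta - 1) * `|g (x r)|.
      have /(ler_wpM2l (powR_ge0 (h r) (theta - 1))) := KL r (ltW r0) hr0.
      by rewrite -/(h r) mulrCA powR_subr1_mul// mulr1.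
    rewrite dotZr.
    have -> : `|w| / (kappa * theta) * (theta * h r `^ (theta - 1) *
        - (lambda r * `|g (x r)| ^+ 2)) =
      - (lambda r * (kappa^-1 * (`|w| * `|g (x r)| *
          (h r `^ (theta - 1) * `|g (x r)|)))).
      by field; rewrite !gt_eqF.
    rewrite mulNr -opprD oppr_le0 -mulrDr mulr_ge0//; first exact: ltW.
    have : `|w| * `|g (x r)| <=
        kappa^-1 * (`|w| * `|g (x r)| * (h r `^ (theta - 1) * `|g (x r)|)).
      rewrite mulrCA ler_peMr ?mulr_ge0//.
      by rewrite -ler_pdivrMl ?invr_gt0// invrK mulr1.
    by lra.
rewrite -/(h s).
(* The choice of [w] makes the increment of the linear term equal to [|w|^2]; one factor [|w|]
   cancels at the end. *)
have -> : dot w (x t) = dot w (x s) + `|w| ^+ 2.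
  by rewrite dot_norm -dotDr; congr (dot w _); rewrite /w addrC subrK.
rewrite -addrA lerD2l => hw.
have [->|w0] := eqVneq w 0; first by rewrite normr0 divr_ge0// ?powR_ge0// ltW.
have nw : 0 < `|w| by rewrite normr_gt0.
rewrite -(ler_pM2l nw) -expr2 mulrA mulrAC.
apply: (le_trans _ hw); rewrite lerDl.
by rewrite mulr_ge0// ?powR_ge0// divr_ge0// ltW.
Qed.

Let minimizer_of_gap (t : R) : f (x t) - f xs <= 0 -> global_minimizer f (x t).
Proof. by move=> ht y; have := xs_min y; lra. Qed.

Let x_cvg_right (c : R) : 0 <= c -> x s @[s --> c^'+] --> x c.
Proof.
rewrite le_eqVlt => /predU1P[<-//|c0]; apply: cvg_at_right_filter.
exact: is_derive_continuous (dx c c0).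
Qed.

(* The flow may reach a minimizer in finite time, where [h^theta] need not be
   differentiable: the bound is extended by continuity to the first time [c]
   at which this happens, and the flow is constant after [c]. *)
Lemma flow_length (s t : R) : 0 <= s -> s <= t ->
  `|x t - x s| <= (f (x s) - f xs) `^ theta / (kappa * theta).
Proof.
move=> s0 st; have [ht|ht] := ltP 0 (f (x t) - f xs).
  exact: flow_length_pos.
have B0 : 0 <= (f (x s) - f xs) `^ theta / (kappa * theta).
  by rewrite divr_ge0 ?powR_ge0// mulr_ge0// ltW.
have [hs|hs] := ltP 0 (f (x s) - f xs); last first.
  by rewrite (flow_stationary _ _ (minimizer_of_gap _ hs) s0 st) subrr normr0.
pose S := [set r | s <= r <= t /\ 0 < f (x r) - f xs].
have Ss : S s by split => //; rewrite lexx.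
have St : ubound S t by move=> r [/andP[]].
have supS : has_sup S by split; [exists s|exists t].
pose c := sup S.
have sc : s <= c by apply: ub_le_sup => //; exists t.
have ct : c <= t by apply: ge_sup => //; exists s.
have c0 : 0 <= c := le_trans s0 sc.
(* Every [r] just after [c] lies outside [S], so [x r] is a minimizer and equals [x t]; right
   continuity at [c] concludes. *)
have -> : x t = x c.
  move: ct; rewrite le_eqVlt => /predU1P[->//|ct].
  apply: (@cvg_unique _ (@norm_hausdorff _ H) (x r @[r --> c^'+])); last first.
    exact: x_cvg_right.
  apply: cvg_near_cst; near=> r.
  have cr : c < r by near: r; exact: nbhs_right_gt.
  have rt : r <= t by near: r; apply: nbhs_right_le.
  apply/esym/flow_stationary => //; last exact: le_trans (ltW cr).
  apply: minimizer_of_gap; rewrite leNgt; apply/negP => hr.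
  have : r <= c.
    apply: ub_le_sup; first by exists t.
    by split => //; rewrite rt (le_trans sc (ltW cr)).
  by rewrite leNgt cr.
move: (sc); rewrite le_eqVlt => /predU1P[<-|sc']; first by rewrite subrr normr0.
have xc : `|x r - x s| @[r --> c^'-] --> `|x c - x s|.
  apply: cvg_norm; apply: cvgB; last exact: cvg_cst.
  apply: cvg_at_left_filter.
  exact: is_derive_continuous (dx c (le_lt_trans s0 sc')).
apply: (cvgr_to_le xc); near=> r.
have rc : r < c by near: r; exact: nbhs_left_lt.
have sr : s <= r by near: r; apply: nbhs_left_ge.
apply: flow_length_pos => //.
have [r' [_ hr'] rr'] := sup_gt (ex_intro _ s Ss) rc.
by apply: (lt_le_trans hr'); apply: h_nincr; [exact: le_trans sr|exact: ltW].
Unshelve. all: by end_near. Qed.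

(** The length bound at time [s] controls all later displacements and tends to 0 with the gap, so
    the trajectory is Cauchy. Continuity of [f] makes the limit a minimizer, and letting the later
    time go to infinity in [flow_length] gives the last bound. *)
Lemma flow_cvg : Gamma lambda t @[t --> +oo] --> +oo ->
  exists xinf : H, [/\ global_minimizer f xinf, x t @[t --> +oo] --> xinf &
    forall t, 0 <= t ->
      `|x t - xinf| <= (f (x t) - f xs) `^ theta / (kappa * theta)].
Proof.
move=> /flow_value_cvg hcvg.
have kt : 0 < kappa * theta by rewrite mulr_gt0.
have /cauchy_cvgP/cvg_ex[xinf xcvg] : cauchy (x t @[t --> +oo]).
  apply: cauchy_exP => e e0.
  (* Chosen so that [d^theta / (kappa theta) = e]. *)
  pose d := (e * (kappa * theta)) `^ theta^-1.
  have d0 : 0 < d by rewrite powR_gt0// mulr_gt0.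
  have : \forall t \near +oo, 0 <= t /\ f (x t) - f xs < d.
    near=> t; split; first by near: t; apply: nbhs_pinfty_ge; rewrite num_real.
    apply: le_lt_trans (ler_norm _) _; rewrite distrC; near: t.
    by move/cvgrPdist_lt : hcvg; exact.
  move=> /filter_ex[s [s0 hs]].
  exists (x s); rewrite /= ; near=> t; rewrite /= -ball_normE /= distrC.
  have st : s <= t by near: t; apply: nbhs_pinfty_ge; rewrite num_real.
  apply: le_lt_trans (flow_length _ _ s0 st) _.
  rewrite ltr_pdivrMr//.
  have -> : e * (kappa * theta) = d `^ theta.
    by rewrite -powRrM mulVf ?gt_eqF// powRr1// ltW// mulr_gt0.
  by apply: gt0_ltr_powR => //; rewrite nnegrE ?h_ge0// ltW.
exists xinf; split => //.
- have fxinf : f (x t) @[t --> +oo] --> f xinf.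
    by apply: continuous_cvg xcvg; exact: is_gradient_continuous.
  by rewrite /global_minimizer (cvg_unique (@Rhausdorff R) fxinf hcvg).
- move=> s s0.
  have xc : `|x s - x t| @[t --> +oo] --> `|x s - xinf|.
    by apply: cvg_norm; apply: cvgB => //; exact: cvg_cst.
  apply: (cvgr_to_le xc); near=> t; rewrite distrC; apply: (flow_length _ _ s0).
  by near: t; apply: nbhs_pinfty_ge; rewrite num_real.
Unshelve. all: by end_near. Qed.

(** Here the squared KL inequality reads [kappa^2 h <= |g|^2], hence [h' <= - kappa^2 lambda h]; the
    integrating factor is [exp (kappa^2 Gamma)]. *)
Lemma flow_gap_exp (t : R) : theta = 2^-1 -> 0 <= t ->
  f (x t) - f xs <= (f (x 0) - f xs) * expR (- kappa ^+ 2 * Gamma lambda t).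
Proof.
move=> theta2 t0.
suff : h t * expR (kappa ^+ 2 * Gamma lambda t) <=
       h 0 * expR (kappa ^+ 2 * Gamma lambda 0).
  by rewrite Gamma0 mulr0 expR0 mulr1 mulNr expRN ler_pdivlMr// expR_gt0.
have gh r : 0 <= r -> kappa ^+ 2 * h r <= `|g (x r)| ^+ 2.
  move=> r0; have [hr|hr] := ltP 0 (h r); last first.
    by apply: (@le_trans _ _ 0); [nra|exact: sqr_ge0].
  have := KL r r0 hr; rewrite theta2 -/(h r) => kl.
  have -> : h r = (h r `^ (1 - 2^-1)) ^+ 2.
    rewrite -powR_mulrn ?powR_ge0// -powRrM (_ : _ * _ = 1) ?powRr1//.
      by field.
  rewrite -exprMn ler_pXn2r// nnegrE// mulr_ge0 ?powR_ge0//; exact: ltW.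
pose E r := expR (kappa ^+ 2 * Gamma lambda r).
apply: (@le0_derive_nincr _ (fun r => h r * E r)
  (fun r => h r * (E r * (kappa ^+ 2 * lambda r)) +
     E r * - (lambda r * `|g (x r)| ^+ 2))) => //.
- apply: cvgM => //; apply: continuous_cvg; first exact: continuous_expR.
  by apply: cvgM; [exact: cvg_cst|exact: cvg_Gamma0].
- move=> r r0 _; apply: is_deriveM; first exact: dh.
  apply: (@is_derive1_comp _ expR).
  by apply: is_deriveZ; exact: is_derive_Gamma.
- move=> r r0 _; have l0 := lambda_gt0 r (ltW r0).
  have E0 : 0 < E r by exact: expR_gt0.
  have -> : h r * (E r * (kappa ^+ 2 * lambda r)) +
     E r * - (lambda r * `|g (x r)| ^+ 2) =
     - (E r * lambda r * (`|g (x r)| ^+ 2 - kappa ^+ 2 * h r)) by ring.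
  by rewrite oppr_le0 mulr_ge0 ?subr_ge0 ?gh ?mulr_ge0// ltW.
Qed.

(** With [p = 1 - 2 theta], the derivative of [h^(- p)] is [p lambda (h^(theta - 1) |g|)^2], at
    least [p kappa^2 lambda] by KL. So [h^(- p)] dominates [kappa^2 p Gamma], and the power
    [- 1 / p] reverses the inequality. *)
Lemma flow_gap_powR (t : R) : theta < 2^-1 -> 0 < t -> 0 < Gamma lambda t ->
  f (x t) - f xs <=
  (kappa ^+ 2 * (1 - 2 * theta) * Gamma lambda t) `^ (- (1 / (1 - 2 * theta))).
Proof.
move=> theta2 t0 G0; set p := 1 - 2 * theta.
have p0 : 0 < p by rewrite /p; lra.
have [ht|ht] := ltP 0 (h t); last by apply: le_trans ht _; exact: powR_ge0.
have hr r : 0 <= r -> r <= t -> 0 < h r.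
  by move=> r0 rt; apply: (lt_le_trans ht); exact: h_nincr.
have h0 := hr 0 (lexx 0) (ltW t0).
have : kappa ^+ 2 * p * Gamma lambda t - h t `^ (- p) <=
       kappa ^+ 2 * p * Gamma lambda 0 - h 0 `^ (- p).
  apply: (@le0_derive_nincr _
    (fun r => kappa ^+ 2 * p * Gamma lambda r - h r `^ (- p))
    (fun r => kappa ^+ 2 * p * lambda r -
      (- p * h r `^ (- p - 1) * - (lambda r * `|g (x r)| ^+ 2))) 0 t)
    => [//||||].
  - exact: ltW.
  - apply: cvgB.
      by apply: cvgM; [exact: cvg_cst|exact: cvg_Gamma0].
    apply: (@continuous_cvg _ _ _ _ _ h (fun r => r `^ (- p))) => //.
    exact: is_derive_continuous (is_derive1_powR (- p) h0).
  - move=> r r0 /andP[_ rt]; apply: is_deriveB.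
      by apply: is_deriveZ; exact: is_derive_Gamma.
    apply: (@is_derive1_comp _ (fun r => r `^ (- p)) h); last exact: dh.
    by apply: is_derive1_powR; apply: hr => //; exact: ltW.
  - move=> r r0 /andP[_ rt]; have l0 := lambda_gt0 r (ltW r0).
    have hr0 := hr r (ltW r0) rt.
    have -> : kappa ^+ 2 * p * lambda r -
      (- p * h r `^ (- p - 1) * - (lambda r * `|g (x r)| ^+ 2)) =
      - (p * lambda r * (h r `^ (- p - 1) * `|g (x r)| ^+ 2 - kappa ^+ 2)).
      by ring.
    rewrite oppr_le0 mulr_ge0//; first by rewrite mulr_ge0// ltW.
    rewrite subr_ge0.
    have -> : h r `^ (- p - 1) = (h r `^ (theta - 1)) ^+ 2.
      rewrite -powR_mulrn ?powR_ge0// -powRrM; congr (_ `^ _).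
      by rewrite /p; ring.
    have k0 := ltW kappa_gt0.
    rewrite -exprMn ler_pXn2r ?nnegrE ?mulr_ge0 ?powR_ge0//.
    have /(ler_wpM2l (powR_ge0 (h r) (theta - 1))) := KL r (ltW r0) hr0.
    by rewrite -/(h r) mulrCA powR_subr1_mul// mulr1.
rewrite Gamma0 mulr0 sub0r => hG.
have c0 : 0 < kappa ^+ 2 * p * Gamma lambda t by rewrite !mulr_gt0 ?exprn_gt0.
have {}hG : kappa ^+ 2 * p * Gamma lambda t <= h t `^ (- p).
  by have := powR_ge0 (h 0) (- p); lra.
have -> : f (x t) - f xs = (h t `^ (- p)) `^ (- (1 / p)).
  rewrite -powRrM (_ : - p * - (1 / p) = 1) ?powRr1 ?ltW//.
  by field; rewrite gt_eqF.
rewrite !(powRN _ (1 / p)) lef_pV2 ?posrE ?powR_gt0//.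
have ip := ltW (divr_gt0 ltr01 p0).
by apply: ge0_ler_powR => //; rewrite nnegrE ?powR_ge0// ltW.
Qed.

End GradientFlow.

(** * Local constancy of [f] for large exponents *)

Section Flatness.
Context (R : realType) (H : completeNormedModType R).
Variable dot : {dot H for (@idfun R)}.
Hypothesis dot_norm : forall u : H, `|u| ^+ 2 = dot u u.
Variables (f : H -> R) (g : H -> H).
Hypothesis f_convex : convex_function [set: convex_lmodType H] f.
Hypothesis f_grad : is_gradient dot f g.

(* For [theta > 1/2] the lower bound [kappa h^(1 - theta) <= |g|] contradicts
   the upper bound [|g|^2 <= 4 L h] as soon as [h] is small and positive. *)
Lemma near_eq_min (xs : H) (kappa theta : R) : global_minimizer f xs ->
  (exists2 U, nbhs xs U & [lipschitz g z | z in U]) ->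
  0 < kappa -> 2^-1 < theta ->
  (\forall y \near xs, f xs < f y ->
    kappa * (f y - f xs) `^ (1 - theta) <= `|g y|) ->
  \forall y \near xs, f y = f xs.
Proof.
move=> xs_min [U /nbhs_ballP[e /= e0 eU] gU] kappa0 theta2 KL.
have [L [L0 gL]] : exists L : R, 0 < L /\ L.-lipschitz_U g.
  have /filter_ex[L [L0 gL]] : \forall L \near +oo, 0 < L /\ L.-lipschitz_U g.
    by apply: filterI => //; apply: nbhs_pinfty_gt; rewrite num_real.
  by exists L.
have e2 : 0 < e / 2 by rewrite divr_gt0.
pose q := 2 * theta - 1.
have q0 : 0 < q by rewrite /q; lra.
(* Threshold below which [h^q < kappa^2 / (4 L)]. *)
pose d := (kappa ^+ 2 / (4 * L)) `^ q^-1.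
have k0 : 0 < kappa ^+ 2 / (4 * L) by rewrite divr_gt0 ?exprn_gt0// mulr_gt0.
have d0 : 0 < d by rewrite powR_gt0.
have fd : \forall y \near xs, `|f xs - f y| < d.
  by move/cvgrPdist_lt : (is_gradient_continuous _ _ _ _ _ f_grad xs); exact.
near=> y; apply/eqP; rewrite eq_le xs_min andbT leNgt; apply/negP => fy.
have hy : 0 < f y - f xs by rewrite subr_gt0.
have KLy : kappa * (f y - f xs) `^ (1 - theta) <= `|g y|.
  by move: fy; near: y.
have : f y - f xs < d.
  apply: le_lt_trans (ler_norm _) _; rewrite distrC; near: y; exact: fd.
have : `|g y| ^+ 2 <= 4 * L * (f y - f xs).
  apply: (sqr_grad_le_gap _ _ _ dot_norm _ _ f_convex f_grad
    _ _ (e / 2) xs_min L0).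
    move=> u v ue ve; apply: (gL (u, v)); split => /=; apply: eU.
      by rewrite -ball_normE/= distrC; lra.
    by rewrite -ball_normE/= distrC; lra.
  near: y; apply/nbhs_ballP; exists (e / 2) => //= z.
  by rewrite -ball_normE/= distrC.
move: (f y - f xs) hy KLy => h h0 KLh gh hd.
(* The squared KL bound and the upper bound on [|g|^2], multiplied by [h^q]: since
   [2 (1 - theta) + q = 1], the left side is linear in [h]. *)
have : kappa ^+ 2 * h <= 4 * L * h * h `^ q.
  have : (kappa * h `^ (1 - theta)) ^+ 2 <= 4 * L * h.
    apply: le_trans gh; rewrite ler_pXn2r ?nnegrE// mulr_ge0 ?powR_ge0//.
    exact: ltW.
  move=> /(ler_wpM2r (powR_ge0 h q)); apply: le_trans.
  rewrite exprMn -[leRHS]mulrA ler_pM2l ?exprn_gt0//.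
  rewrite -powR_mulrn ?powR_ge0// -powRrM -powRD; last first.
    by apply/implyP => _; rewrite gt_eqF.
  by rewrite (_ : (1 - theta) * 2%:R + q = 1) ?powRr1 ?(ltW h0)// /q; ring.
have : h `^ q < kappa ^+ 2 / (4 * L).
  have -> : kappa ^+ 2 / (4 * L) = d `^ q.
    by rewrite -powRrM mulVf ?gt_eqF// powRr1// ltW.
  by apply: gt0_ltr_powR => //; rewrite nnegrE ltW.
have L4 : 0 < 4 * L * h by rewrite !mulr_gt0.
rewrite -(ltr_pM2l L4) => hq /le_lt_trans/(_ hq).
have -> : 4 * L * h * (kappa ^+ 2 / (4 * L)) = kappa ^+ 2 * h.
  by field; rewrite gt_eqF.
by rewrite ltxx.
Unshelve. all: by end_near. Qed.

End Flatness.

(** * The KL inequality in power form *)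

Lemma derive1_phi (R : realType) (kappa theta s : R) :
  0 < kappa -> 0 < theta -> 0 < s ->
  derive1 (phi kappa theta) s = kappa^-1 * s `^ (theta - 1).
Proof.
move=> kappa0 theta0 s0; rewrite derive1E.
have d : is_derive s 1 (phi kappa theta)
    ((kappa * theta)^-1 *: (theta * s `^ (theta - 1))).
  rewrite (_ : phi kappa theta = (kappa * theta)^-1 \*: (@powR R ^~ theta)).
    by apply: is_deriveZ; exact: is_derive1_powR.
  by apply/funext => r; rewrite /phi /= mulrC.
have [_ ->] := d; rewrite /GRing.scale/=.
by field; rewrite !gt_eqF.
Qed.

(** Multiplying by [kappa s^(1 - theta)] cancels the derivative of [phi] and leaves the Lojasiewicz
    gradient inequality. *)
Lemma KL_powR (R : realType) (kappa theta s n : R) :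
  0 < kappa -> 0 < theta -> 0 < s ->
  1 <= derive1 (phi kappa theta) s * n -> kappa * s `^ (1 - theta) <= n.
Proof.
move=> kappa0 theta0 s0; rewrite derive1_phi// => h.
have := ler_wpM2l (ltW kappa0) (ler_wpM2l (powR_ge0 s (1 - theta)) h).
rewrite mulr1 => /le_trans; apply.
have -> : kappa * (s `^ (1 - theta) * (kappa^-1 * s `^ (theta - 1) * n)) =
    s `^ (theta - 1) * s `^ (1 - theta) * n by field; rewrite gt_eqF.
by rewrite powR_subr1_mul// mul1r.
Qed.

(** * Choice of the radius, convergence and the three regimes *)

Theorem theorem1p4 (R : realType) (H : completeNormedModType R)
  (dot : {dot H for (@idfun R)})
  (dot_norm : forall u : H, `|u| ^+ 2 = dot u u)
  (lambda : R -> R)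
  (lambda_gt0 : forall t : R, 0 <= t -> 0 < lambda t)
  (lambda_ac : forall T : R, 0 <= T -> abs_continuous 0 T lambda)
  (f : H -> R) (gradf : H -> H)
  (f_convex : convex_function [set: convex_lmodType H] f)
  (f_grad : is_gradient dot f gradf)
  (gradf_cont : continuous gradf)
  (gradf_lip : forall y : H,
     exists2 U, nbhs y U & [lipschitz gradf z | z in U])
  (lambda_int :
    (\int[lebesgue_measure]_(t in `[0%R, +oo[) (lambda t)%:E = +oo)%E)
  (xstar : H) (xstar_min : global_minimizer f xstar)
  (rstar : \bar R) (rstar_gt0 : (0 < rstar)%E)
  (kappa theta : R) (kappa_gt0 : 0 < kappa)
  (theta_gt0 : 0 < theta) (theta_le1 : theta <= 1)
  (KL : forall y : H, (`|y - xstar|%:E < rstar)%E -> f xstar < f y ->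
     1 <= derive1 (phi kappa theta) (f y - f xstar) * `|gradf y|) :
  exists r0 : \bar R, [/\ (0 < r0)%E, (r0 <= rstar)%E &
    forall (x0 : H) (x : R -> H), (`|x0 - xstar|%:E < r0)%E ->
      gradient_solution lambda gradf x0 x ->
      exists xinf : H,
        [/\ global_minimizer f xinf,
            x t @[t --> +oo] --> xinf,
            1 / 2 < theta ->
              f x0 = f xstar /\ forall t : R, 0 <= t -> x t = x0,
            theta = 1 / 2 ->
              exists2 delta : R, 0 < delta &
                ((fun t => `|x t - xinf|) =O_ (pinfty_nbhs R)
                  (fun t => expR (- delta * Gamma lambda t))) /\
                ((fun t => f (x t) - f xstar) =O_ (pinfty_nbhs R)
                  (fun t => expR (- delta * Gamma lambda t)))
          & theta < 1 / 2 ->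
              ((fun t => `|x t - xinf|) =O_ (pinfty_nbhs R)
                (fun t => Gamma lambda t `^ (- (theta / (1 - 2 * theta))))) /\
              ((fun t => f (x t) - f xstar) =O_ (pinfty_nbhs R)
                (fun t => Gamma lambda t `^ (- (1 / (1 - 2 * theta)))))]].
Proof.
have KL' y : (`|y - xstar|%:E < rstar)%E -> 0 < f y - f xstar ->
    kappa * (f y - f xstar) `^ (1 - theta) <= `|gradf y|.
  move=> yr fy; apply: (KL_powR _ _ _ _ _ kappa_gt0 theta_gt0 fy).
  by apply: KL => //; rewrite -subr_gt0.
(* A finite radius is taken even if [rstar] is infinite; for [theta > 1/2] it is shrunk until [f] is
   constant on the ball. *)
have [r [r0 rr flat]] : exists r : R, [/\ 0 < r, (r%:E <= rstar)%E &
    1 / 2 < theta -> forall y, `|y - xstar| < r -> f y = f xstar].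
  have [e e0 er] : exists2 e : R, 0 < e & (e%:E <= rstar)%E.
    case: (rstar) rstar_gt0 => [s||] //; first by rewrite lte_fin; exists s.
    by move=> _; exists 1; rewrite ?leey.
  have [theta2|theta2] := ltP (1 / 2) theta; last by exists e; split=> //; lra.
  have : \forall y \near xstar, f y = f xstar.
    apply: (near_eq_min _ _ _ dot_norm _ _ f_convex f_grad _ kappa theta) => //.
      by rewrite -div1r.
    apply/nbhs_ballP; exists e => //= y; rewrite -ball_normE/= distrC => ye fy.
    apply: KL'; last by rewrite subr_gt0.
    by apply: lt_le_trans er; rewrite lte_fin.
  move=> /nbhs_ballP[d /= d0 dP]; exists (Order.min e d); split.
  - by rewrite lt_min e0.
  - by apply: le_trans er; rewrite lee_fin ge_min lexx.
  - move=> _ y; rewrite lt_min => /andP[_ yd]; apply: dP.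
    by rewrite -ball_normE/= distrC.
exists r%:E; split => // x0 x; rewrite lte_fin => x0r x_sol.
have x0E : x 0 = x0 by case: x_sol => ? [].
have dx := gradient_solution_derive _ _ _ _ _ _ x_sol.
have xc := gradient_solution_cvg0 _ _ _ _ _ _ x_sol.
have KLx t : 0 <= t -> 0 < f (x t) - f xstar ->
    kappa * (f (x t) - f xstar) `^ (1 - theta) <= `|gradf (x t)|.
  move=> t0; apply: KL'; apply: lt_le_trans rr; rewrite lte_fin.
  apply: le_lt_trans x0r; rewrite -x0E.
  exact: (flow_dist_nincr _ _ _ dot_norm lambda _ _ _ f_convex f_grad).
have Goo := cvg_Gamma_pinfty _ _ lambda_ac lambda_gt0 lambda_int.
have [xinf [xinf_min xcvg xdist]] := flow_cvg _ _ _ dot_norm _ _ _ _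
  f_convex f_grad lambda_gt0 lambda_ac dx xc _ xstar_min _ _
  kappa_gt0 theta_gt0 KLx Goo.
have hge0 t : 0 <= f (x t) - f xstar by rewrite subr_ge0; exact: xstar_min.
exists xinf; split => //.
- move=> /flat/(_ _ x0r) fx0; split => // t t0; rewrite -x0E.
  apply: (flow_stationary _ _ _ dot_norm lambda _ _ _ f_convex f_grad) => //.
  by move=> y; rewrite x0E fx0; exact: xstar_min.
- rewrite div1r => theta2.
  have gap t : 0 <= t -> f (x t) - f xstar <=
      (f (x 0) - f xstar) * expR (- kappa ^+ 2 * Gamma lambda t).
    exact: (flow_gap_exp _ _ _ dot_norm _ _ _ _
      f_grad lambda_gt0 lambda_ac dx xc _ xstar_min _ _ kappa_gt0 KLx _ theta2).
  have k0 : 0 < kappa ^+ 2 by rewrite exprn_gt0.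
  have kt : 0 < kappa * theta by rewrite mulr_gt0.
  (* The gap decays at rate [kappa^2], so the distance, bounded by its power [theta], decays at rate
     [kappa^2 theta]; this slower rate serves for both estimates. *)
  exists (kappa ^+ 2 * theta); first by rewrite mulr_gt0.
  have c0 := powR_ge0 (f (x 0) - f xstar) theta.
  split; apply/eqO_exP.
  + exists (1 + (f (x 0) - f xstar) `^ theta / (kappa * theta)).
      by rewrite ltr_pwDl// divr_ge0// ltW.
    near=> t; rewrite normr_id gtr0_norm ?expR_gt0//.
    have t0 : 0 <= t by near: t; apply: nbhs_pinfty_ge; rewrite num_real.
    apply: (le_trans (xdist t t0)); rewrite [leRHS]mulrDl mul1r.
    apply: ler_wpDl; first exact: expR_ge0.
    rewrite [leRHS]mulrAC ler_pM2r ?invr_gt0//.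
    have -> : - (kappa ^+ 2 * theta) * Gamma lambda t =
        - kappa ^+ 2 * Gamma lambda t * theta by ring.
    rewrite expRM -powRM ?expR_ge0//.
    by apply: ge0_ler_powR; rewrite ?nnegrE ?mulr_ge0 ?expR_ge0// ?gap// ltW.
  + exists (1 + (f (x 0) - f xstar)); first by rewrite ltr_pwDl.
    near=> t; rewrite ger0_norm// gtr0_norm ?expR_gt0//.
    have t0 : 0 <= t by near: t; apply: nbhs_pinfty_ge; rewrite num_real.
    apply: (le_trans (gap t t0)); rewrite [leRHS]mulrDl mul1r.
    apply: ler_wpDl; first exact: expR_ge0.
    rewrite ler_wpM2l// ler_expR.
    have G0 := Gamma_ge0 _ _ lambda_ac lambda_gt0 _ t0.
    by rewrite theta2; nra.
- rewrite div1r => theta2.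
  have p0 : 0 < 1 - 2 * theta by lra.
  set c := kappa ^+ 2 * (1 - 2 * theta).
  have c0 : 0 < c by rewrite mulr_gt0// exprn_gt0.
  set a := - (1 / (1 - 2 * theta)).
  have gap t : 0 < t -> 0 < Gamma lambda t ->
      f (x t) - f xstar <= c `^ a * Gamma lambda t `^ a.
    move=> t0 G0; rewrite -powRM ?(ltW c0) ?(ltW G0)//.
    exact: (flow_gap_powR _ _ _ dot_norm _ _ _ _
      f_grad lambda_gt0 lambda_ac dx xc _ _ _ kappa_gt0 KLx _ theta2).
  have kt : 0 < kappa * theta by rewrite mulr_gt0.
  have ca : 0 < c `^ a by rewrite powR_gt0.
  have tG : \forall t \near +oo, 0 < t /\ 0 < Gamma lambda t.
    near=> t; split; near: t; last by move/cvgryPgt : Goo; exact.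
    by apply: nbhs_pinfty_gt; rewrite num_real.
  split; apply/eqO_exP.
  + exists ((c `^ a) `^ theta / (kappa * theta)).
      by rewrite divr_gt0// powR_gt0.
    near=> t; rewrite normr_id ger0_norm ?powR_ge0//.
    have [t0 G0] : 0 < t /\ 0 < Gamma lambda t by near: t; exact: tG.
    apply: (le_trans (xdist t (ltW t0))).
    rewrite [leRHS]mulrAC ler_pM2r ?invr_gt0//.
    (* The distance exponent is [theta] times the gap exponent [a], by the length bound. *)
    have -> : - (theta / (1 - 2 * theta)) = a * theta.
      by rewrite /a; field; rewrite gt_eqF.
    rewrite powRrM -powRM ?powR_ge0//.
    apply: ge0_ler_powR; [exact: ltW|exact: hge0| |exact: gap].
    by rewrite nnegrE mulr_ge0 ?powR_ge0.
  + exists (c `^ a) => //.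
    near=> t; rewrite !ger0_norm ?powR_ge0//.
    have [t0 G0] : 0 < t /\ 0 < Gamma lambda t by near: t; exact: tG.
    exact: gap.
Unshelve. all: by end_near. Qed.
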